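(* Let $A$ be a commutative ring with unit, let $X=\operatorname{Spec} A$ with the Zariski topology, and let $\mathcal O_X$ be the sheaf of rings associated to the presheaf $O_X$ defined in the context. Then: (1) for every prime ideal $\mathfrak p\in X$ there is a ring isomorphism $\mathcal O_{X,\mathfrak p}\simeq A_{\mathfrak p}$; (2) for every $f\in A$ there is a ring isomorphism $\mathcal O_X(D(f))\simeq A_f$.
   Context: Let $A$ be a commutative ring with unit. $X=\operatorname{Spec} A$ is the set of prime ideals of $A$, whose closed sets are $V(\mathfrak a)=\{\mathfrak p\in X\mid \mathfrak a\subseteq\mathfrak p\}$ for ideals $\mathfrak a\subseteq A$. For $f\in A$, $D(f)=\{\mathfrak p\in X\mid f\notin\mathfrak p\}$, and $A_f$ is the localization of $A$ at the powers of $f$. For a prime $\mathfrak p$, $\rho_{\mathfrak p}:A\to A_{\mathfrak p}$ is the localization homomorphism. For an open set $U\subseteq X$ put $\tilde O_X(U)=\prod_{\mathfrak p\in U}A_{\mathfrak p}$ and $\rho=\prod_{\mathfrak p\in U}\rho_{\mathfrak p}:A\to\tilde O_X(U)$. Let $O_X(U)$ be the subring of $\tilde O_X(U)$ generated by $\rho(A)$ together with the elements $\rho(a)^{-1}$ for all $a\in A$ such that $\rho(a)$ is invertible in $\tilde O_X(U)$. With the restriction maps induced by the projections of products, $O_X$ is a presheaf of rings on $X$. The sheaf associated to a presheaf $F$ on $X$ is a sheaf $\mathcal F$ on $X$ with a morphism $\theta:F\to\mathcal F$ such that for every sheaf $\mathcal G$ on $X$ and every morphism $\phi:F\to\mathcal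 G$ there is a unique morphism $\psi:\mathcal F\to\mathcal G$ with $\phi=\psi\circ\theta$. $\mathcal O_X$ denotes the sheaf associated to $O_X$. The stalk of a (pre)sheaf $F$ at $x\in X$ is the direct limit $F_x=\varinjlim_{x\in U}F(U)$ over the open sets $U$ containing $x$; $\mathcal O_{X,\mathfrak p}$ is the stalk of $\mathcal O_X$ at $\mathfrak p$. *)

(* Defs.v *)
From HB Require Import structures.
From mathcomp Require Import all_boot all_algebra all_classical topology ring.

Set Implicit Arguments.
Unset Strict Implicit.
Unset Printing Implicit Defensive.

Import GRing.Theory.
Local Open Scope classical_set_scope.
Local Open Scope ring_scope.
Local Open Scope quotient_scope.

(* Rings are [comPzRingType]s because the zero ring must be allowed, both as a
   base ring and as a ring of sections (over the empty set, for instance);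
   [comNzRingType], on which the library's [prime_idealr] is built, excludes it. *)

Definition ring_iso (R S : comPzRingType) : Prop :=
  exists f : {rmorphism R -> S}, bijective f.

Definition dprod_ring (I : Type) (R : I -> comPzRingType) : Type :=
  forall i, R i.

Section DependentProduct.
Variables (I : Type) (R : I -> comPzRingType).
Implicit Types x y z : dprod_ring R.

HB.instance Definition _ := gen_eqMixin (dprod_ring R).
HB.instance Definition _ := gen_choiceMixin (dprod_ring R).

Let zero : dprod_ring R := fun=> 0.
Let opp x : dprod_ring R := fun i => - x i.
Let add x y : dprod_ring R := fun i => x i + y i.
Let one : dprod_ring R := fun=> 1.
Let mul x y : dprod_ring R := fun i => x i * y i.

Let addA : associative add.
Proof. by move=> x y z; apply: functional_extensionality_dep => i; exact: addrA. Qed.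
Let addC : commutative add.
Proof. by move=> x y; apply: functional_extensionality_dep => i; exact: addrC. Qed.
Let add0 : left_id zero add.
Proof. by move=> x; apply: functional_extensionality_dep => i; exact: add0r. Qed.
Let addN : left_inverse zero opp add.
Proof. by move=> x; apply: functional_extensionality_dep => i; exact: addNr. Qed.
Let mulA : associative mul.
Proof. by move=> x y z; apply: functional_extensionality_dep => i; exact: mulrA. Qed.
Let mulC : commutative mul.
Proof. by move=> x y; apply: functional_extensionality_dep => i; exact: mulrC. Qed.
Let mul1 : left_id one mul.
Proof. by move=> x; apply: functional_extensionality_dep => i; exact: mul1r. Qed.
Let mulDl : left_distributive mul add.
Proof. by move=> x y z; apply: functional_extensionality_dep => i; exact: mulrDl. Qed.

HB.instance Definition _ :=
  GRing.isZmodule.Build (dprod_ring R) addA addC add0 addN.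
HB.instance Definition _ :=
  GRing.Zmodule_isComPzRing.Build (dprod_ring R) mulA mulC mul1 mulDl.

End DependentProduct.

Definition generated_subring (R : comPzRingType) (S : set R) : set R :=
  smallest [set B : set R | GRing.subring_closed (fun x => x \in B)] S.

Section GeneratedSubring.
Variables (R : comPzRingType) (S : set R).

Lemma generated_subring_closed :
  GRing.subring_closed (fun x => x \in generated_subring S).
Proof.
split=> [|x y xS yS|x y xS yS]; apply/mem_set => B HB;
  have [[B1 BB BM] _] := HB; apply: set_mem.
- exact: B1.
- by apply: BB; apply/mem_set; [exact: set_mem xS _ HB | exact: set_mem yS _ HB].
- by apply: BM; apply/mem_set; [exact: set_mem xS _ HB | exact: set_mem yS _ HB].
Qed.

Definition subring_gen : Type := generated_subring S.

HB.instance Definition _ := SubChoice.copy subring_gen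
  {x : R | x \in generated_subring S}.
HB.instance Definition _ := GRing.SubChoice_isSubComPzRing.Build
  R (fun x => x \in generated_subring S) subring_gen generated_subring_closed.

End GeneratedSubring.

Record mulset (A : comPzRingType) := Mulset {
  mulset_set :> set A;
  mulset1 : mulset_set 1;
  mulsetM : forall s t, mulset_set s -> mulset_set t -> mulset_set (s * t)
}.

Section Localization.
Variables (A : comPzRingType) (S : mulset A).

Definition frac : Type := A * (S : set A).

HB.instance Definition _ := Choice.on frac.

Definition Frac (a : A) (s : A) (Ss : mulset_set S s) : frac :=
  (a, exist (fun x => x \in (S : set A)) s (mem_set Ss)).

Definition num (x : frac) : A := x.1.
Definition den (x : frac) : A := val x.2.
Lemma denP x : mulset_set S (den x). Proof. exact: set_mem (valP x.2). Qed.

Definition frac_eq (x y : frac) : bool :=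
  `[< exists2 u, mulset_set S u & u * (num x * den y) = u * (num y * den x) >].

Lemma frac_eq_refl : reflexive frac_eq.
Proof. by move=> x; apply/asboolP; exists 1 => //; exact: mulset1. Qed.
Lemma frac_eq_sym : symmetric frac_eq.
Proof.
by move=> x y; apply/asboolP/asboolP => -[u Su uE]; exists u => //; rewrite uE.
Qed.
Lemma frac_eq_trans : transitive frac_eq.
Proof.
move=> y x z /asboolP[u Su uE] /asboolP[v Sv vE]; apply/asboolP.
exists (u * v * den y); first by do 2?apply: mulsetM => //; exact: denP.
transitivity (v * den z * (u * (num x * den y))); first by ring.
by rewrite uE; transitivity (u * den x * (v * (num y * den z)));
  [ring | rewrite vE; ring].
Qed.

Canonical frac_equiv := EquivRel frac_eq frac_eq_refl frac_eq_sym frac_eq_trans.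

Definition localization : Type := {eq_quot frac_equiv}.
HB.instance Definition _ := EqQuotient.on localization.
HB.instance Definition _ := Choice.on localization.

Lemma frac_eqP (x y : frac) :
  \pi_localization x = \pi y <->
  exists2 u, mulset_set S u & u * (num x * den y) = u * (num y * den x).
Proof. by split=> [/eqmodP /asboolP|?]; last by apply/eqmodP/asboolP. Qed.

Definition zerof := Frac 0 (mulset1 S).
Definition onef := Frac 1 (mulset1 S).
Definition oppf x := Frac (- num x) (denP x).
Definition addf x y :=
  Frac (num x * den y + num y * den x) (mulsetM (denP x) (denP y)).
Definition mulf x y := Frac (num x * num y) (mulsetM (denP x) (denP y)).

Definition loc0 : localization := \pi_localization zerof.
Definition loc1 : localization := \pi_localization onef.
Definition loc_opp := lift_op1 localization oppf.
Definition loc_add := lift_op2 localization addf.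
Definition loc_mul := lift_op2 localization mulf.

Let repr_eq (x : frac) : exists2 u, mulset_set S u &
  u * (num x * den (repr (\pi_localization x))) =
  u * (num (repr (\pi_localization x)) * den x).
Proof. by apply/frac_eqP; rewrite reprK. Qed.

Lemma pi_loc_opp : {morph \pi_localization : x / oppf x >-> loc_opp x}.
Proof.
move=> x; unlock loc_opp; apply/frac_eqP.
have [u Su] := repr_eq x; move: (repr _) => x'.
rewrite /num /den => uE; exists u; rewrite //= /num /den /=.
by rewrite !mulNr !mulrN uE.
Qed.

Lemma pi_loc_add : {morph \pi_localization : x y / addf x y >-> loc_add x y}.
Proof.
move=> x y; unlock loc_add; apply/frac_eqP.
have [u Su] := repr_eq x; have [v Sv] := repr_eq y.
move: (repr (\pi_localization x)) (repr (\pi_localization y)) => x' y' vE uE.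
exists (u * v); first exact: mulsetM.
transitivity (v * den y * den y' * (u * (num x * den x'))
  + u * den x * den x' * (v * (num y * den y'))).
  by rewrite /addf /num /den /=; ring.
by rewrite uE vE /addf /num /den /=; ring.
Qed.

Lemma pi_loc_mul : {morph \pi_localization : x y / mulf x y >-> loc_mul x y}.
Proof.
move=> x y; unlock loc_mul; apply/frac_eqP.
have [u Su] := repr_eq x; have [v Sv] := repr_eq y.
move: (repr (\pi_localization x)) (repr (\pi_localization y)) => x' y' vE uE.
exists (u * v); first exact: mulsetM.
transitivity (u * (num x * den x') * (v * (num y * den y'))).
  by rewrite /mulf /num /den /=; ring.
by rewrite uE vE /mulf /num /den /=; ring.
Qed.

Let loc_addA : associative loc_add.
Proof.
elim/quotW=> x; elim/quotW=> y; elim/quotW=> z; rewrite -!pi_loc_add.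
apply/frac_eqP; exists 1; first exact: mulset1.
by rewrite ?/zerof /onef /oppf /addf /mulf /num /den /=; ring.
Qed.
Let loc_addC : commutative loc_add.
Proof.
elim/quotW=> x; elim/quotW=> y; rewrite -!pi_loc_add.
apply/frac_eqP; exists 1; first exact: mulset1.
by rewrite ?/zerof /onef /oppf /addf /mulf /num /den /=; ring.
Qed.
Let loc_add0 : left_id loc0 loc_add.
Proof.
elim/quotW=> x; rewrite -!pi_loc_add.
apply/frac_eqP; exists 1; first exact: mulset1.
by rewrite ?/zerof /onef /oppf /addf /mulf /num /den /=; ring.
Qed.
Let loc_addN : left_inverse loc0 loc_opp loc_add.
Proof.
elim/quotW=> x; rewrite -pi_loc_opp -!pi_loc_add.
apply/frac_eqP; exists 1; first exact: mulset1.
by rewrite ?/zerof /onef /oppf /addf /mulf /num /den /=; ring.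
Qed.
Let loc_mulA : associative loc_mul.
Proof.
elim/quotW=> x; elim/quotW=> y; elim/quotW=> z; rewrite -!pi_loc_mul.
apply/frac_eqP; exists 1; first exact: mulset1.
by rewrite ?/zerof /onef /oppf /addf /mulf /num /den /=; ring.
Qed.
Let loc_mulC : commutative loc_mul.
Proof.
elim/quotW=> x; elim/quotW=> y; rewrite -!pi_loc_mul.
apply/frac_eqP; exists 1; first exact: mulset1.
by rewrite ?/zerof /onef /oppf /addf /mulf /num /den /=; ring.
Qed.
Let loc_mul1 : left_id loc1 loc_mul.
Proof.
elim/quotW=> x; rewrite -!pi_loc_mul.
apply/frac_eqP; exists 1; first exact: mulset1.
by rewrite ?/zerof /onef /oppf /addf /mulf /num /den /=; ring.
Qed.
Let loc_mulDl : left_distributive loc_mul loc_add.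
Proof.
elim/quotW=> x; elim/quotW=> y; elim/quotW=> z.
rewrite -pi_loc_add -!pi_loc_mul -pi_loc_add.
apply/frac_eqP; exists 1; first exact: mulset1.
by rewrite ?/zerof /onef /oppf /addf /mulf /num /den /=; ring.
Qed.

HB.instance Definition _ :=
  GRing.isZmodule.Build localization loc_addA loc_addC loc_add0 loc_addN.
HB.instance Definition _ := GRing.Zmodule_isComPzRing.Build localization
  loc_mulA loc_mulC loc_mul1 loc_mulDl.

Definition to_loc (a : A) : localization := \pi_localization (Frac a (mulset1 S)).

Lemma to_loc_is_zmod_morphism : zmod_morphism to_loc.
Proof.
move=> a b; rewrite /to_loc -[X in _ = _ + X]pi_loc_opp -[RHS]pi_loc_add.
apply/frac_eqP; exists 1; first exact: mulset1.
by rewrite ?/zerof /onef /oppf /addf /mulf /num /den /=; ring.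
Qed.
Lemma to_loc_is_monoid_morphism : monoid_morphism to_loc.
Proof.
split=> // a b; rewrite /to_loc -[RHS]pi_loc_mul.
apply/frac_eqP; exists 1; first exact: mulset1.
by rewrite ?/zerof /onef /oppf /addf /mulf /num /den /=; ring.
Qed.
HB.instance Definition _ :=
  GRing.isZmodMorphism.Build A localization to_loc to_loc_is_zmod_morphism.
HB.instance Definition _ :=
  GRing.isMonoidMorphism.Build A localization to_loc to_loc_is_monoid_morphism.

End Localization.

Section Powers.
Variables (A : comPzRingType) (f : A).

Lemma powers1 : [set f ^+ n | n in [set: nat]] 1.
Proof. by exists 0%N. Qed.
Lemma powersM (s t : A) : [set f ^+ n | n in [set: nat]] s ->
  [set f ^+ n | n in [set: nat]] t -> [set f ^+ n | n in [set: nat]] (s * t).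
Proof. by move=> [m _ <-] [n _ <-]; exists (m + n)%N; rewrite ?exprD. Qed.

Definition powers : mulset A := Mulset powers1 powersM.

Definition loc_elt : comPzRingType := localization powers.

End Powers.

Section Ideals.
Variable A : comPzRingType.

Definition ideal (I : set A) : Prop :=
  [/\ I 0, forall x y, I x -> I y -> I (x + y) & forall a x, I x -> I (a * x)].

Definition prime_ideal (I : set A) : Prop :=
  [/\ ideal I, ~ I 1 & forall x y, I (x * y) -> I x \/ I y].

End Ideals.

Record spec (A : comPzRingType) := Spec {
  spec_set :> set A;
  spec_prime : prime_ideal spec_set
}.

Section Zariski.
Variable A : comPzRingType.

HB.instance Definition _ := gen_eqMixin (spec A).
HB.instance Definition _ := gen_choiceMixin (spec A).

Definition zeros (I : set A) : set (spec A) := [set p | I `<=` p].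

Definition zariski_open : set_system (spec A) :=
  [set U | exists2 I, ideal I & ~` U = zeros I].

Lemma zariski_openT : zariski_open setT.
Proof.
exists setT; first by split.
rewrite setCT; apply/esym; rewrite -subset0 => p /= pT.
by have [_ + _] := spec_prime p; apply; exact: pT.
Qed.

Lemma zariski_openI : setI_closed zariski_open.
Proof.
move=> U V [I [I0 ID IM] UI] [J [J0 JD JM] VJ]; exists (I `&` J).
  split=> [|x y [? ?] [? ?]|a x [? ?]]; first by split.
    by split; [exact: ID | exact: JD].
  by split; [exact: IM | exact: JM].
rewrite setCI UI VJ; apply/seteqP; split=> p /=.
  by move=> [Ip|Jp] x [Ix Jx]; [exact: Ip | exact: Jp].
move=> IJp; apply: contrapT => /not_orP[/existsNP[x /not_implyP[Ix px]]].
move=> /existsNP[y /not_implyP[Jy py]].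
have [_ _ /(_ x y)] := spec_prime p; case=> //.
by apply: IJp; split; [rewrite mulrC; exact: IM | exact: JM].
Qed.

Lemma zariski_open_bigU (I : Type) (U : I -> set (spec A)) :
  (forall i, zariski_open (U i)) -> zariski_open (\bigcup_i U i).
Proof.
move=> Uo; exists (smallest (@ideal A)
  (\bigcup_(J in [set J | exists i, ~` U i = zeros J]) J)).
  split=> [B [[]]//|x y xI yI B HB|a x xI B HB]; have [[_ BD BM] _] := HB.
  - by apply: BD; [exact: xI | exact: yI].
  - by apply: BM; exact: xI.
rewrite setC_bigcup; apply/seteqP; split=> p /=.
  move=> pU x; apply; split; first by have [] := spec_prime p.
  by move=> y [J [i UJ] Jy]; have := pU i Logic.I; rewrite UJ; exact.
move=> Ip i _; have [J _ UJ] := Uo i; rewrite UJ => x Jx; apply: Ip.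
by move=> B [_]; apply; exists J => //; exists i.
Qed.

HB.instance Definition _ := isOpenTopological.Build (spec A)
  zariski_openT zariski_openI zariski_open_bigU.

Lemma closed_specE (C : set (spec A)) :
  closed C <-> exists2 I, ideal I & C = zeros I.
Proof.
by rewrite -openC; split=> -[I idI CI]; exists I => //; move: CI; rewrite setCK.
Qed.

End Zariski.

Record opens (X : topologicalType) := Opens {
  opens_set :> set X;
  opens_open : open opens_set
}.

(* Canonical, so that the inclusions [subIsetl] and [subIsetr] can be passed to
   [res] directly. *)
Canonical opensI (X : topologicalType) (U V : opens X) : opens X :=
  Opens (openI (opens_open U) (opens_open V)).

Record presheaf (X : topologicalType) := Presheaf {
  sections :> opens X -> comPzRingType;
  res : forall U V : opens X, V `<=` U -> {rmorphism sections U -> sections V};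
  res_id : forall (U : opens X) (UU : U `<=` U) s, res UU s = s;
  res_comp : forall (U V W : opens X) (VU : V `<=` U) (WV : W `<=` V)
    (WU : W `<=` U) s, res WV (res VU s) = res WU s
}.

Lemma res_eqW (X : topologicalType) (F : presheaf X) (U V W W' : opens X)
    (WU : W `<=` U) (WV : W `<=` V) (W'U : W' `<=` U) (W'V : W' `<=` V) s t :
  W' `<=` W -> res F WU s = res F WV t -> res F W'U s = res F W'V t.
Proof.
by move=> W'W E; rewrite -(res_comp WU W'W) E (res_comp WV W'W W'V).
Qed.

Record presheaf_hom (X : topologicalType) (F G : presheaf X) := PresheafHom {
  hom_at :> forall U : opens X, {rmorphism F U -> G U};
  hom_res : forall (U V : opens X) (VU : V `<=` U) s,
    hom_at V (res F VU s) = res G VU (hom_at U s)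
}.

(* The index type may be empty, so the sections over [set0] form the zero ring. *)
Definition is_sheaf (X : topologicalType) (F : presheaf X) : Prop :=
  forall (I : Type) (U : opens X) (V : I -> opens X)
    (VU : forall i, V i `<=` U), U `<=` \bigcup_i V i ->
  (forall s t : F U, (forall i, res F (VU i) s = res F (VU i) t) -> s = t) /\
  (forall s : forall i, F (V i),
    (forall i j, res F (@subIsetl _ (V i) (V j)) (s i) =
                 res F (@subIsetr _ (V i) (V j)) (s j)) ->
    exists t : F U, forall i, res F (VU i) t = s i).

(* Equality of morphisms is stated sectionwise. *)
Definition is_associated_sheaf (X : topologicalType) (F FF : presheaf X)
    (theta : presheaf_hom F FF) : Prop :=
  is_sheaf FF /\
  forall (G : presheaf X), is_sheaf G -> forall phi : presheaf_hom F G,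
    exists psi : presheaf_hom FF G,
      (forall U s, phi U s = psi U (theta U s)) /\
      (forall psi' : presheaf_hom FF G,
        (forall U s, phi U s = psi' U (theta U s)) -> forall U, psi' U =1 psi U).

Section Stalk.
Variables (X : topologicalType) (F : presheaf X) (x : X).

Record local_section := LocalSection {
  dom : opens X;
  dom_mem : opens_set dom x;
  sec : F dom
}.

HB.instance Definition _ := gen_eqMixin local_section.
HB.instance Definition _ := gen_choiceMixin local_section.

Definition same_germ (s t : local_section) : bool :=
  `[< exists (W : opens X) (Ws : W `<=` dom s) (Wt : W `<=` dom t),
        opens_set W x /\ res F Ws (sec s) = res F Wt (sec t) >].

Lemma same_germ_refl : reflexive same_germ.
Proof.
move=> s; apply/asboolP; exists (dom s), (@subset_refl _ _), (@subset_refl _ _).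
by split=> //; exact: dom_mem.
Qed.
Lemma same_germ_sym : symmetric same_germ.
Proof.
by move=> s t; apply/asboolP/asboolP => -[W [Ws [Wt [Wx E]]]];
  exists W, Wt, Ws.
Qed.
Lemma same_germ_trans : transitive same_germ.
Proof.
move=> t s u /asboolP[V [Vs [Vt [Vx EV]]]] /asboolP[W [Wt [Wu [Wx EW]]]].
apply/asboolP; exists (opensI V W).
exists (subset_trans (@subIsetl _ V W) Vs), (subset_trans (@subIsetr _ V W) Wu).
split=> //; transitivity (res F (subset_trans (@subIsetl _ V W) Vt) (sec t)).
  exact: res_eqW (@subIsetl _ V W) EV.
exact: res_eqW (@subIsetr _ V W) EW.
Qed.

Canonical germ_equiv :=
  EquivRel same_germ same_germ_refl same_germ_sym same_germ_trans.

Definition stalk : Type := {eq_quot germ_equiv}.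
HB.instance Definition _ := EqQuotient.on stalk.
HB.instance Definition _ := Choice.on stalk.

Lemma germ_eqP (s t : local_section) :
  \pi_stalk s = \pi t <->
  exists (W : opens X) (Ws : W `<=` dom s) (Wt : W `<=` dom t),
    opens_set W x /\ res F Ws (sec s) = res F Wt (sec t).
Proof. by split=> [/eqmodP /asboolP|?]; last by apply/eqmodP/asboolP. Qed.

Definition cst_section (n : forall U : opens X, F U) : local_section :=
  @LocalSection (Opens openT) Logic.I (n _).
Definition map_section (f : forall U, F U -> F U) (s : local_section) :=
  LocalSection (dom_mem s) (f _ (sec s)).
Definition map2_section (f : forall U, F U -> F U -> F U)
    (s t : local_section) : local_section :=
  @LocalSection (opensI (dom s) (dom t)) (conj (dom_mem s) (dom_mem t))
    (f _ (res F (@subIsetl _ (dom s) (dom t)) (sec s))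
         (res F (@subIsetr _ (dom s) (dom t)) (sec t))).

Definition stalk0 : stalk := \pi_stalk (cst_section (fun U => 0)).
Definition stalk1 : stalk := \pi_stalk (cst_section (fun U => 1)).
Definition stalk_opp := lift_op1 stalk (map_section (fun U s => - s)).
Definition stalk_add := lift_op2 stalk (map2_section (fun U s t => s + t)).
Definition stalk_mul := lift_op2 stalk (map2_section (fun U s t => s * t)).

Let repr_germ (s : local_section) :
  exists (W : opens X) (Ws : W `<=` dom s)
    (Wt : W `<=` dom (repr (\pi_stalk s))),
    opens_set W x /\ res F Ws (sec s) = res F Wt (sec (repr (\pi_stalk s))).
Proof. by apply/germ_eqP; rewrite reprK. Qed.

Lemma pi_map_section (f : forall U, F U -> F U) :
    (forall (U V : opens X) (VU : V `<=` U) s,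
      res F VU (f U s) = f V (res F VU s)) ->
  {morph \pi_stalk : s / map_section f s >->
    \pi_stalk (map_section f (repr s))}.
Proof.
move=> fE s; apply/germ_eqP; have [W [Ws [Wt [Wx E]]]] := repr_germ s.
by exists W, Ws, Wt; split=> //=; rewrite !fE E.
Qed.

Lemma pi_map2_section (f : forall U, F U -> F U -> F U) :
    (forall (U V : opens X) (VU : V `<=` U) s t,
      res F VU (f U s t) = f V (res F VU s) (res F VU t)) ->
  {morph \pi_stalk : s t / map2_section f s t >->
    \pi_stalk (map2_section f (repr s) (repr t))}.
Proof.
move=> fE s t; apply/germ_eqP.
have [V [Vs [Vs' [Vx EV]]]] := repr_germ s.
have [W [Wt [Wt' [Wx EW]]]] := repr_germ t.
exists (opensI V W), (setISS Vs Wt), (setISS Vs' Wt'); split=> //=.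
have [VWs VWs'] := (subset_trans (@subIsetl _ V W) Vs,
                    subset_trans (@subIsetl _ V W) Vs').
have [VWt VWt'] := (subset_trans (@subIsetr _ V W) Wt,
                    subset_trans (@subIsetr _ V W) Wt').
rewrite !fE !(res_comp _ _ VWs) !(res_comp _ _ VWs').
rewrite !(res_comp _ _ VWt) !(res_comp _ _ VWt').
congr (f _ _ _); first exact: res_eqW (@subIsetl _ V W) EV.
exact: res_eqW (@subIsetr _ V W) EW.
Qed.

Lemma pi_stalk_opp :
  {morph \pi_stalk : s / map_section (fun U s => - s) s >-> stalk_opp s}.
Proof.
by move=> s; unlock stalk_opp; apply: pi_map_section => *; exact: rmorphN.
Qed.
Lemma pi_stalk_add :
  {morph \pi_stalk : s t / map2_section (fun U s t => s + t) s t >->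
    stalk_add s t}.
Proof.
by move=> s t; unlock stalk_add; apply: pi_map2_section => *; exact: rmorphD.
Qed.
Lemma pi_stalk_mul :
  {morph \pi_stalk : s t / map2_section (fun U s t => s * t) s t >->
    stalk_mul s t}.
Proof.
by move=> s t; unlock stalk_mul; apply: pi_map2_section => *; exact: rmorphM.
Qed.

Definition germ (U : opens X) (Ux : opens_set U x) (s : F U) : stalk :=
  \pi_stalk (LocalSection Ux s).

Lemma germ_res (U V : opens X) (Ux : opens_set U x) (Vx : opens_set V x)
  (VU : V `<=` U) (s : F U) : germ Vx (res F VU s) = germ Ux s.
Proof.
apply/germ_eqP; exists V, (@subset_refl _ _), VU; split=> //=.
exact: res_comp.
Qed.

Lemma germP (a : stalk) :
  exists (U : opens X) (Ux : opens_set U x) (s : F U), a = germ Ux s.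
Proof. by elim/quotW: a => -[U Ux s]; exists U, Ux, s. Qed.

Lemma germ2P (a b : stalk) :
  exists (U : opens X) (Ux : opens_set U x) (s t : F U),
    a = germ Ux s /\ b = germ Ux t.
Proof.
have [U [Ux [s ->]]] := germP a; have [V [Vx [t ->]]] := germP b.
have UVx : opens_set (opensI U V) x by split.
exists (opensI U V), UVx, (res F (@subIsetl _ U V) s).
by exists (res F (@subIsetr _ U V) t); rewrite !(germ_res _ UVx).
Qed.

Lemma germ3P (a b c : stalk) :
  exists (U : opens X) (Ux : opens_set U x) (s t u : F U),
    [/\ a = germ Ux s, b = germ Ux t & c = germ Ux u].
Proof.
have [U [Ux [s [t [-> ->]]]]] := germ2P a b; have [V [Vx [u ->]]] := germP c.
have UVx : opens_set (opensI U V) x by split.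
exists (opensI U V), UVx, (res F (@subIsetl _ U V) s).
exists (res F (@subIsetl _ U V) t), (res F (@subIsetr _ U V) u).
by rewrite !(germ_res _ UVx).
Qed.

Section GermOperations.
Variables (U : opens X) (Ux : opens_set U x).

Let UI : U `<=` opensI U U. Proof. by move=> y Uy; split. Qed.
Let UT : U `<=` Opens openT. Proof. by []. Qed.
Let UU : U `<=` U. Proof. by []. Qed.

Lemma germ0E : stalk0 = germ Ux 0.
Proof. by apply/germ_eqP; exists U, UT, UU; rewrite !rmorph0. Qed.
Lemma germ1E : stalk1 = germ Ux 1.
Proof. by apply/germ_eqP; exists U, UT, UU; rewrite !rmorph1. Qed.
Lemma germNE (s : F U) : stalk_opp (germ Ux s) = germ Ux (- s).
Proof. by rewrite -pi_stalk_opp. Qed.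
Lemma germDE (s t : F U) : stalk_add (germ Ux s) (germ Ux t) = germ Ux (s + t).
Proof.
rewrite -pi_stalk_add; apply/germ_eqP; exists U, UI, UU; split=> //=.
by rewrite !rmorphD !(res_comp _ _ UU).
Qed.
Lemma germME (s t : F U) : stalk_mul (germ Ux s) (germ Ux t) = germ Ux (s * t).
Proof.
rewrite -pi_stalk_mul; apply/germ_eqP; exists U, UI, UU; split=> //=.
by rewrite !rmorphM !(res_comp _ _ UU).
Qed.

End GermOperations.

Let stalk_addA : associative stalk_add.
Proof.
move=> a b c; have [U [Ux [s [t [u [-> -> ->]]]]]] := germ3P a b c.
by rewrite !germDE addrA.
Qed.
Let stalk_addC : commutative stalk_add.
Proof.
move=> a b; have [U [Ux [s [t [-> ->]]]]] := germ2P a b.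
by rewrite !germDE addrC.
Qed.
Let stalk_add0 : left_id stalk0 stalk_add.
Proof.
move=> a; have [U [Ux [s ->]]] := germP a.
by rewrite (germ0E Ux) germDE add0r.
Qed.
Let stalk_addN : left_inverse stalk0 stalk_opp stalk_add.
Proof.
move=> a; have [U [Ux [s ->]]] := germP a.
by rewrite (germ0E Ux) germNE germDE addNr.
Qed.
Let stalk_mulA : associative stalk_mul.
Proof.
move=> a b c; have [U [Ux [s [t [u [-> -> ->]]]]]] := germ3P a b c.
by rewrite !germME mulrA.
Qed.
Let stalk_mulC : commutative stalk_mul.
Proof.
move=> a b; have [U [Ux [s [t [-> ->]]]]] := germ2P a b.
by rewrite !germME mulrC.
Qed.
Let stalk_mul1 : left_id stalk1 stalk_mul.
Proof.
move=> a; have [U [Ux [s ->]]] := germP a.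
by rewrite (germ1E Ux) germME mul1r.
Qed.
Let stalk_mulDl : left_distributive stalk_mul stalk_add.
Proof.
move=> a b c; have [U [Ux [s [t [u [-> -> ->]]]]]] := germ3P a b c.
by rewrite !(germDE, germME) mulrDl.
Qed.

HB.instance Definition _ :=
  GRing.isZmodule.Build stalk stalk_addA stalk_addC stalk_add0 stalk_addN.
HB.instance Definition _ := GRing.Zmodule_isComPzRing.Build stalk
  stalk_mulA stalk_mulC stalk_mul1 stalk_mulDl.

End Stalk.

(* The usual construction, showing that associated sheaves exist: families of
   germs that are locally the germs of a section. *)
Section Sheafification.
Variables (X : topologicalType) (F : presheaf X).

Definition etale_sections (U : opens X) : comPzRingType :=
  dprod_ring (fun p : (U : set X) => stalk F (val p)).

Definition opens_mem (U : opens X) (p : (U : set X)) : opens_set U (val p) :=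
  set_mem (valP p).

Definition opens_pt (U : opens X) (p : X) (Up : opens_set U p) : (U : set X) :=
  exist (fun q => q \in (U : set X)) p (mem_set Up).

Lemma opens_ptE (U : opens X) (p : (U : set X)) (Up : opens_set U (val p)) :
  opens_pt Up = p.
Proof. exact: val_inj. Qed.

Definition represents (U V : opens X) (s : etale_sections U) (t : F V) : Prop :=
  forall (p : X) (Up : opens_set U p) (Vp : opens_set V p),
    s (opens_pt Up) = germ Vp t.

Definition locally_germ (U : opens X) : set (etale_sections U) :=
  [set s | forall p, opens_set U p -> exists (V : opens X) (t : F V),
    [/\ V `<=` U, opens_set V p & represents s t] ].
Arguments locally_germ : clear implicits.

Lemma represents_res (U V W : opens X) (WV : W `<=` V) (s : etale_sections U)
  (t : F V) : represents s t -> represents s (res F WV t).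
Proof. by move=> st p Up Wp; rewrite (germ_res (WV _ Wp)). Qed.

Lemma represents1 (U V : opens X) : represents (1 : etale_sections U) (1 : F V).
Proof. by move=> p Up Vp; exact: germ1E. Qed.

Lemma representsB (U V : opens X) (s s' : etale_sections U) (t t' : F V) :
  represents s t -> represents s' t' -> represents (s - s') (t - t').
Proof.
move=> st st' p Up Vp.
transitivity (s (opens_pt Up) - s' (opens_pt Up)) => //.
by rewrite (st _ _ Vp) (st' _ _ Vp); symmetry; rewrite -germDE -germNE.
Qed.

Lemma representsM (U V : opens X) (s s' : etale_sections U) (t t' : F V) :
  represents s t -> represents s' t' -> represents (s * s') (t * t').
Proof.
move=> st st' p Up Vp.
transitivity (s (opens_pt Up) * s' (opens_pt Up)) => //.
by rewrite (st _ _ Vp) (st' _ _ Vp); symmetry; rewrite -germME.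
Qed.

Lemma locally_germ2 (U : opens X) (s s' : etale_sections U) (p : X) :
    opens_set U p -> locally_germ U s -> locally_germ U s' ->
  exists (V : opens X) (t t' : F V),
    [/\ V `<=` U, opens_set V p, represents s t & represents s' t'].
Proof.
move=> Up /(_ p Up)[V [t [VU Vp st]]] /(_ p Up)[V' [t' [_ Vp' st']]].
exists (opensI V V'), (res F (@subIsetl _ V V') t), (res F (@subIsetr _ V V') t').
split=> //; [by move=> q [/VU] | exact: represents_res | exact: represents_res].
Qed.

Lemma locally_germ_subring (U : opens X) :
  GRing.subring_closed (fun s => s \in locally_germ U).
Proof.
split=> [|s s' /set_mem sP /set_mem sP'|s s' /set_mem sP /set_mem sP'];
  apply/mem_set => p Up.
- by exists U, 1; split=> //; exact: represents1.
- have [V [t [t' [VU Vp st st']]]] := locally_germ2 Up sP sP'.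
  by exists V, (t - t'); split=> //; exact: representsB.
- have [V [t [t' [VU Vp st st']]]] := locally_germ2 Up sP sP'.
  by exists V, (t * t'); split=> //; exact: representsM.
Qed.

Definition sheafify_sections (U : opens X) : Type :=
  {s : etale_sections U | s \in locally_germ U}.
HB.instance Definition _ U := SubChoice.copy (sheafify_sections U)
  {s : etale_sections U | s \in locally_germ U}.
HB.instance Definition _ U := GRing.SubChoice_isSubComPzRing.Build
  (etale_sections U) (fun s => s \in locally_germ U) (sheafify_sections U)
  (locally_germ_subring U).

Lemma sheafify_eq (U : opens X) (s t : sheafify_sections U) :
  (forall p (Up : opens_set U p), val s (opens_pt Up) = val t (opens_pt Up)) ->
  s = t.
Proof.
move=> st; apply: val_inj; apply: functional_extensionality_dep => p.
by rewrite -(opens_ptE (opens_mem p)); exact: st.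
Qed.

Section Restriction.
Variables (U V : opens X) (VU : V `<=` U).

Definition etale_res (s : etale_sections U) : etale_sections V :=
  fun p => s (opens_pt (VU (opens_mem p))).

Lemma etale_resE s p (Vp : opens_set V p) (Up : opens_set U p) :
  etale_res s (opens_pt Vp) = s (opens_pt Up).
Proof.
rewrite /etale_res /opens_pt /=; set Up' := mem_set _; set Up'' := mem_set _.
by rewrite (eq_irrelevance Up' Up'').
Qed.

Lemma etale_res_locally_germ s :
  s \in locally_germ U -> etale_res s \in locally_germ V.
Proof.
move=> /set_mem sU; apply/mem_set => p Vp.
have [W [t [WU Wp st]]] := sU p (VU Vp).
exists (opensI V W), (res F (@subIsetr _ V W) t).
split=> // [q []//|]; apply: represents_res => q Vq Wq.
by rewrite (etale_resE s Vq (VU Vq)); exact: st.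
Qed.

Definition sheafify_res (s : sheafify_sections U) : sheafify_sections V :=
  exist (fun t => t \in locally_germ V) (etale_res (val s))
    (etale_res_locally_germ (valP s)).

Lemma sheafify_res_is_zmod_morphism : zmod_morphism sheafify_res.
Proof. by move=> s t; exact: val_inj. Qed.
Lemma sheafify_res_is_monoid_morphism : monoid_morphism sheafify_res.
Proof. by split=> [|s t]; exact: val_inj. Qed.
HB.instance Definition _ := GRing.isZmodMorphism.Build
  (sheafify_sections U) (sheafify_sections V) sheafify_res
  sheafify_res_is_zmod_morphism.
HB.instance Definition _ := GRing.isMonoidMorphism.Build
  (sheafify_sections U) (sheafify_sections V) sheafify_res
  sheafify_res_is_monoid_morphism.

End Restriction.

Lemma sheafify_res_id (U : opens X) (UU : U `<=` U) s : sheafify_res UU s = s.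
Proof. by apply: sheafify_eq => p Up; exact: etale_resE. Qed.

Lemma sheafify_res_comp (U V W : opens X) (VU : V `<=` U) (WV : W `<=` V)
  (WU : W `<=` U) s : sheafify_res WV (sheafify_res VU s) = sheafify_res WU s.
Proof.
apply: sheafify_eq => p Wp.
by rewrite /= !(etale_resE _ _ _ (WV _ Wp)) !(etale_resE _ _ _ (WU _ Wp)).
Qed.

Definition sheafify : presheaf X :=
  @Presheaf X (fun U => sheafify_sections U : comPzRingType)
    (fun U V VU => sheafify_res VU) sheafify_res_id sheafify_res_comp.

Section Unit.
Variable U : opens X.

Definition etale_unit (s : F U) : etale_sections U :=
  fun p => germ (opens_mem p) s.

Lemma etale_unitE s : represents (etale_unit s) s.
Proof.
move=> p Up Up'; rewrite /etale_unit.
by rewrite (Prop_irrelevance (opens_mem (opens_pt Up)) Up').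
Qed.

Lemma etale_unit_locally_germ s : etale_unit s \in locally_germ U.
Proof.
by apply/mem_set => p Up; exists U, s; split=> //; exact: etale_unitE.
Qed.

Definition sheafify_unit (s : F U) : sheafify_sections U :=
  exist (fun t => t \in locally_germ U) (etale_unit s)
    (etale_unit_locally_germ s).

Lemma sheafify_unit_is_zmod_morphism : zmod_morphism sheafify_unit.
Proof.
move=> s t; apply: val_inj; apply: functional_extensionality_dep => p.
by rewrite /= /etale_unit -germDE -germNE.
Qed.
Lemma sheafify_unit_is_monoid_morphism : monoid_morphism sheafify_unit.
Proof.
split=> [|s t]; apply: val_inj; apply: functional_extensionality_dep => p.
  by rewrite /= /etale_unit -germ1E.
by rewrite /= /etale_unit -germME.
Qed.
HB.instance Definition _ := GRing.isZmodMorphism.Build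
  (F U) (sheafify_sections U) sheafify_unit sheafify_unit_is_zmod_morphism.
HB.instance Definition _ := GRing.isMonoidMorphism.Build
  (F U) (sheafify_sections U) sheafify_unit sheafify_unit_is_monoid_morphism.

End Unit.

Lemma sheafify_unit_res (U V : opens X) (VU : V `<=` U) s :
  sheafify_unit (res F VU s) = res sheafify VU (sheafify_unit s).
Proof.
apply: sheafify_eq => p Vp; rewrite /= (etale_resE _ _ _ (VU _ Vp)).
by rewrite (etale_unitE _ _ Vp) (etale_unitE _ _ (VU _ Vp)); exact: germ_res.
Qed.

Definition sheafify_hom : presheaf_hom F sheafify :=
  @PresheafHom X F sheafify (fun U => sheafify_unit (U := U)) sheafify_unit_res.

Lemma sheafify_is_sheaf : is_sheaf sheafify.
Proof.
move=> I U V VU UV; split=> [s t st|s sE].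
  apply: sheafify_eq => p Up; have [i _ Vp] := UV p Up.
  have := congr1 (fun r : sheafify_sections (V i) => val r (opens_pt Vp)) (st i).
  by rewrite /= !(etale_resE _ _ _ Up).
have sE' i j p (Vp : opens_set (V i) p) (Vp' : opens_set (V j) p) :
    val (s i) (opens_pt Vp) = val (s j) (opens_pt Vp').
  have Vij : opens_set (opensI (V i) (V j)) p by split.
  have := congr1 (fun r : sheafify_sections _ => val r (opens_pt Vij)) (sE i j).
  by rewrite /= (etale_resE _ _ _ Vp) (etale_resE _ _ _ Vp').
have idx (p : (U : set X)) : {i | opens_set (V i) (val p)}.
  by apply: cid; have [i _ Vp] := UV _ (opens_mem p); exists i.
pose t : etale_sections U := fun p => val (s _) (opens_pt (projT2 (idx p))).
have tE i p (Up : opens_set U p) (Vp : opens_set (V i) p) :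
    t (opens_pt Up) = val (s i) (opens_pt Vp) by exact: sE'.
have tP : t \in locally_germ U.
  apply/mem_set => p Up; have [i _ Vp] := UV p Up.
  have [W [r [WV Wp sr]]] := set_mem (valP (s i)) p Vp.
  exists W, r; split=> // [|q Uq Wq]; first exact: subset_trans WV (VU i).
  by rewrite (tE i q Uq (WV _ Wq)); exact: sr.
exists (exist (fun t => t \in locally_germ U) t tP : sheafify_sections U) => i.
apply: sheafify_eq => p Vp.
by rewrite /= (etale_resE _ _ _ (VU i _ Vp)); exact: tE.
Qed.

Section Universal.
Variables (G : presheaf X) (G_sheaf : is_sheaf G) (phi : presheaf_hom F G).

Lemma sheaf_eq (U : opens X) (a b : G U) :
  (forall p, opens_set U p -> exists (V : opens X) (VU : V `<=` U),
     opens_set V p /\ res G VU a = res G VU b) -> a = b.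
Proof.
move=> ab.
pose I := {V : opens X | exists VU : V `<=` U, res G VU a = res G VU b}.
have VU (i : I) : sval i `<=` U by have [VU _] := svalP i.
have cov : U `<=` \bigcup_(i : I) sval i.
  move=> p /ab[V [VU' [Vp E]]].
  by exists (exist _ V (ex_intro _ VU' E) : I).
have [loc _] := G_sheaf VU cov; apply: loc => i.
by have [VU' E] := svalP i; rewrite (Prop_irrelevance (VU i) VU').
Qed.

Lemma represents_agree (U V W : opens X) (s : etale_sections U) (t : F V)
    (t' : F W) (VU : V `<=` U) : represents s t -> represents s t' ->
  res G (@subIsetl _ V W) (phi V t) = res G (@subIsetr _ V W) (phi W t').
Proof.
move=> st st'; apply: sheaf_eq => p -[Vp Wp].
have /germ_eqP[Z [Zs [Zt [Zp /= E]]]] : germ Vp t = germ Wp t'.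
  by rewrite -(st p (VU _ Vp)) (st' _ _ Wp).
have ZI : Z `<=` opensI V W by move=> q Zq; split; [exact: (Zs q) | exact: (Zt q)].
exists Z, ZI; split=> //.
by rewrite (res_comp _ _ Zs) (res_comp _ _ Zt) -!hom_res E.
Qed.

Definition extends (U : opens X) (s : etale_sections U) (a : G U) : Prop :=
  forall (V : opens X) (VU : V `<=` U) (t : F V),
    represents s t -> res G VU a = phi V t.

Lemma extends_ex (U : opens X) (s : sheafify_sections U) :
  exists a, extends (val s) a.
Proof.
pose I := {V : opens X & {t : F V | V `<=` U /\ represents (val s) t}}.
pose V (i : I) := tag i; pose t (i : I) : F (V i) := sval (tagged i).
have VU (i : I) : V i `<=` U by have [] := svalP (tagged i).
have st (i : I) : represents (val s) (t i) by have [] := svalP (tagged i).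
have cov : U `<=` \bigcup_i V i.
  move=> p Up; have [W [r [WU Wp sr]]] := set_mem (valP s) p Up.
  by exists (existT _ W (exist _ r (conj WU sr))).
have [_ glue] := G_sheaf VU cov.
have [i j|a aE] := glue (fun i => phi (V i) (t i)).
  exact: represents_agree (VU i) (st i) (st j).
exists a => W WU r sr.
pose i : I := existT _ W (exist _ r (conj WU sr)).
by rewrite (Prop_irrelevance WU (VU i)); exact: aE i.
Qed.

Lemma extends_uniq (U : opens X) (s : sheafify_sections U) (a b : G U) :
  extends (val s) a ->
  (forall p, opens_set U p -> exists (V : opens X) (VU : V `<=` U) (t : F V),
     [/\ opens_set V p, represents (val s) t & res G VU b = phi V t]) ->
  b = a.
Proof.
move=> sa sb; apply: sheaf_eq => p /sb[V [VU [t [Vp st bt]]]].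
by exists V, VU; split; rewrite // bt (sa V VU t).
Qed.

Definition extension (U : opens X) (s : sheafify U) : G U :=
  projT1 (cid (extends_ex s)).

Lemma extensionP (U : opens X) (s : sheafify U) :
  extends (val s) (extension s).
Proof. exact: projT2 (cid (extends_ex s)). Qed.

Lemma extension_is_zmod_morphism U : zmod_morphism (@extension U).
Proof.
move=> s s'; symmetry; apply: (extends_uniq (@extensionP U (s - s'))) => p Up.
have [V [t [t' [VU Vp st st']]]] :=
  locally_germ2 Up (set_mem (valP s)) (set_mem (valP s')).
exists V, VU, (t - t'); split=> //; first by rewrite rmorphB; exact: representsB.
by rewrite !rmorphB (extensionP VU st) (extensionP VU st').
Qed.

Lemma extension_is_monoid_morphism U : monoid_morphism (@extension U).
Proof.
split=> [|s s']; symmetry.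
  apply: (extends_uniq (@extensionP U 1)) => p Up.
  exists U, (@subset_refl _ _), 1; split=> //; last by rewrite !rmorph1.
  by rewrite rmorph1; exact: represents1.
apply: (extends_uniq (@extensionP U (s * s'))) => p Up.
have [V [t [t' [VU Vp st st']]]] :=
  locally_germ2 Up (set_mem (valP s)) (set_mem (valP s')).
exists V, VU, (t * t'); split=> //; first by rewrite rmorphM; exact: representsM.
by rewrite !rmorphM (extensionP VU st) (extensionP VU st').
Qed.

HB.instance Definition _ U := GRing.isZmodMorphism.Build
  (sheafify U) (G U) (@extension U) (@extension_is_zmod_morphism U).
HB.instance Definition _ U := GRing.isMonoidMorphism.Build
  (sheafify U) (G U) (@extension U) (@extension_is_monoid_morphism U).

Lemma extension_res (U V : opens X) (VU : V `<=` U) (s : sheafify U) :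
  extension (res sheafify VU s) = res G VU (extension s).
Proof.
symmetry; apply: (extends_uniq (@extensionP V _)) => p Vp.
have [W [t [WV Wp st]]] := set_mem (valP (res sheafify VU s)) p Vp.
exists W, WV, t; split=> //.
rewrite (res_comp _ _ (subset_trans WV VU)); apply: extensionP => q Uq Wq.
by rewrite -(etale_resE VU _ (WV _ Wq)); exact: st.
Qed.

Definition extension_hom : presheaf_hom sheafify G :=
  @PresheafHom X sheafify G (fun U => @extension U) extension_res.

End Universal.

Lemma sheafify_associated : is_associated_sheaf sheafify_hom.
Proof.
split=> [|G G_sheaf phi]; first exact: sheafify_is_sheaf.
exists (extension_hom G_sheaf phi); split=> [U s|psi psiE U s].
  have := @extensionP G G_sheaf phi U (sheafify_unit s) U (@subset_refl _ U) s
    (etale_unitE s).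
  by rewrite res_id.
apply: (@extends_uniq G G_sheaf phi U s _ _ (@extensionP G G_sheaf phi U s)).
move=> p Up.
have [V [t [VU Vp st]]] := set_mem (valP s) p Up.
exists V, VU, t; split=> //; rewrite -hom_res psiE; congr (psi V _).
apply: sheafify_eq => q Vq.
by rewrite /= (etale_resE _ _ _ (VU _ Vq)) (st _ _ Vq) (etale_unitE _ _ Vq).
Qed.

End Sheafification.

Section SpecPresheaf.
Variable A : comPzRingType.

Definition basic_open_set (f : A) : set (spec A) := [set p | ~ spec_set p f].

Lemma open_basic_open_set (f : A) : open (basic_open_set f).
Proof.
exists [set a * f | a in [set: A]].
  split=> [|x y [a _ <-] [b _ <-]|a x [b _ <-]].
  - by exists 0; rewrite ?mul0r.
  - by exists (a + b); rewrite ?mulrDl.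
  - by exists (a * b); rewrite ?mulrA.
apply/seteqP; split=> p /=.
  move=> /contrapT pf _ [a _ <-].
  by have [[_ _ pM] _ _] := spec_prime p; exact: pM.
by move=> fp; apply; apply: fp; exists 1; rewrite ?mul1r.
Qed.

Definition basic_open (f : A) : opens (spec A) :=
  Opens (open_basic_open_set f).

Section LocalizationAtPrime.
Variable p : spec A.

Lemma compl_prime1 : (~` p) 1.
Proof. by have [] := spec_prime p. Qed.
Lemma compl_primeM s t : (~` p) s -> (~` p) t -> (~` p) (s * t).
Proof. by have [_ _ pM] := spec_prime p; move=> ps pt /pM[]. Qed.

Definition compl_prime : mulset A := Mulset compl_prime1 compl_primeM.

Definition loc_at : comPzRingType := localization compl_prime.

Definition rho_at : {rmorphism A -> loc_at} := @to_loc A compl_prime.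

End LocalizationAtPrime.

Definition tildeO (U : opens (spec A)) : comPzRingType :=
  dprod_ring (fun p : (U : set (spec A)) => loc_at (val p)).

Definition rho (U : opens (spec A)) (a : A) : tildeO U :=
  fun p => rho_at (val p) a.
Arguments rho : clear implicits.

(* An inverse in a commutative ring is unique, so the second set consists of
   the [(rho U a)^-1] for those [a] such that [rho U a] is invertible. *)
Definition O_generators (U : opens (spec A)) : set (tildeO U) :=
  range (rho U) `|` [set y | exists a, rho U a * y = 1].
Arguments O_generators : clear implicits.

Definition O_sections (U : opens (spec A)) : comPzRingType :=
  subring_gen (O_generators U).

Section Restriction.
Variables (U V : opens (spec A)) (VU : V `<=` U).

Definition subset_point (p : (V : set (spec A))) : (U : set (spec A)) :=
  exist (fun q => q \in (U : set (spec A))) (val p)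
    (mem_set (VU (set_mem (valP p)))).

Definition tilde_res (s : tildeO U) : tildeO V := fun p => s (subset_point p).

Lemma tilde_res_is_zmod_morphism : zmod_morphism tilde_res.
Proof. by move=> s t; exact: functional_extensionality_dep. Qed.
Lemma tilde_res_is_monoid_morphism : monoid_morphism tilde_res.
Proof. by split=> [|s t]; exact: functional_extensionality_dep. Qed.
HB.instance Definition _ := GRing.isZmodMorphism.Build (tildeO U) (tildeO V)
  tilde_res tilde_res_is_zmod_morphism.
HB.instance Definition _ := GRing.isMonoidMorphism.Build (tildeO U) (tildeO V)
  tilde_res tilde_res_is_monoid_morphism.

Lemma tilde_res_generated (s : tildeO U) :
  s \in generated_subring (O_generators U) ->
  tilde_res s \in generated_subring (O_generators V).
Proof.
move=> /set_mem sU.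
have [G1 GB GM] := generated_subring_closed (O_generators V).
apply: (sU [set t | tilde_res t \in generated_subring (O_generators V)]).
split.
  split=> [|x y /set_mem/= xV /set_mem/= yV|x y /set_mem/= xV /set_mem/= yV];
    apply/mem_set => /=.
  - by rewrite rmorph1.
  - by rewrite rmorphB; exact: GB.
  - by rewrite rmorphM; exact: GM.
move=> t [[a _ <-]|[a ay]]; apply/mem_set => B [_ GB']; apply: GB'.
  by left; exists a.
right; exists a; apply: functional_extensionality_dep => p.
by have := congr1 (fun f : tildeO U => f (subset_point p)) ay.
Qed.

Definition O_res (s : O_sections U) : O_sections V :=
  exist (fun t : tildeO V => t \in generated_subring (O_generators V))
    (tilde_res (val s)) (tilde_res_generated (valP s)).

Lemma O_res_is_zmod_morphism : zmod_morphism O_res.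
Proof. by move=> s t; apply: val_inj; rewrite /= rmorphB. Qed.
Lemma O_res_is_monoid_morphism : monoid_morphism O_res.
Proof. by split=> [|s t]; apply: val_inj; rewrite /= ?rmorph1 ?rmorphM. Qed.
HB.instance Definition _ := GRing.isZmodMorphism.Build
  (O_sections U) (O_sections V) O_res O_res_is_zmod_morphism.
HB.instance Definition _ := GRing.isMonoidMorphism.Build
  (O_sections U) (O_sections V) O_res O_res_is_monoid_morphism.

End Restriction.

Lemma O_res_id (U : opens (spec A)) (UU : U `<=` U) s : O_res UU s = s.
Proof.
apply: val_inj; apply: functional_extensionality_dep => -[p Up] /=.
by rewrite /tilde_res /subset_point /=; set Up' := mem_set _;
  rewrite (eq_irrelevance Up' Up).
Qed.

Lemma O_res_comp (U V W : opens (spec A)) (VU : V `<=` U) (WV : W `<=` V)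
  (WU : W `<=` U) s : O_res WV (O_res VU s) = O_res WU s.
Proof.
apply: val_inj; apply: functional_extensionality_dep => -[p Wp] /=.
by rewrite /tilde_res /subset_point /=; set Up := mem_set _;
  set Up' := mem_set _; rewrite (eq_irrelevance Up' Up).
Qed.

Definition O_presheaf : presheaf (spec A) :=
  @Presheaf _ O_sections (fun U V VU => O_res VU) O_res_id O_res_comp.

End SpecPresheaf.

Arguments rho {A} U a.
Arguments O_generators {A} U.

(* Main.v *)
(* Both isomorphisms come from one criterion: a ring morphism [g] out of [A]
   identifies its target with [S^-1 A] as soon as it inverts [S], every element
   of its kernel is killed by some [s] in [S], and every [r] satisfies
   [g s * r = g a] for some [s] in [S].  Sections of [O_X] over [U] are fractions
   [a / s] with [s] vanishing nowhere on [U], and sections of the associated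
   sheaf are locally such.  This settles the stalks directly.  On [D(f)], the
   annihilator of an element of the kernel, and the conductor of a section into
   the image of [A], are ideals contained in no prime that avoids [f]; hence each
   of them contains a power of [f]. *)
Require Import Defs.
From mathcomp Require Import all_boot all_algebra all_classical topology.
From HB Require Import structures.
From mathcomp Require Import ring.

Set Implicit Arguments.
Unset Strict Implicit.
Unset Printing Implicit Defensive.

Import GRing.Theory.
Local Open Scope classical_set_scope.
Local Open Scope ring_scope.
Local Open Scope quotient_scope.

(** * Prime ideals avoiding a power set, and a criterion for localizations *)

(** Krull's argument: an ideal maximal among those that contain [I] and miss every power of [f] is
    prime. *)
Lemma prime_avoiding_powers (A : comPzRingType) (I : set A) (f : A) :
    ideal I -> (forall n, ~ I (f ^+ n)) ->
  exists p : spec A, I `<=` p /\ ~ spec_set p f.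
Proof.
move=> idI fI.
(* Joining [I] to [J] lets the empty chain, whose union is the empty set, satisfy the hypothesis of
   Zorn's lemma. *)
pose P := [set J : set A | ideal (I `|` J) /\ forall n, ~ (I `|` J) (f ^+ n)].
have [F FP tot|M [[idQ fQ] maxM]] := @Zorn_bigcup A P.
  split=> [|n [/fI//|[J /FP[_ fJ] Jf]]]; last by apply: (fJ n); right.
  have [I0 ID IM] := idI; split=> [|x y|a x].
  - by left.
  - case=> [Ix|[J FJ Jx]] [Iy|[J' FJ' Jy]].
    + by left; exact: ID.
    + have [[_ JD _] _] := FP _ FJ'.
      have [|Jxy] := JD x y (or_introl Ix) (or_intror Jy); first by left.
      by right; exists J'.
    + have [[_ JD _] _] := FP _ FJ.
      have [|Jxy] := JD x y (or_intror Jx) (or_introl Iy); first by left.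
      by right; exists J.
    + have [JJ'|J'J] := tot _ _ FJ FJ'.
        have [[_ JD _] _] := FP _ FJ'.
        have [|Jxy] := JD x y (or_intror (JJ' _ Jx)) (or_intror Jy); first by left.
        by right; exists J'.
      have [[_ JD _] _] := FP _ FJ.
      have [|Jxy] := JD x y (or_intror Jx) (or_intror (J'J _ Jy)); first by left.
      by right; exists J.
  - case=> [Ix|[J FJ Jx]]; first by left; exact: IM.
    have [[_ _ JM] _] := FP _ FJ.
    have [|Jax] := JM a x (or_intror Jx); first by left.
    by right; exists J.
pose Q := I `|` M; have [Q0 QD QM] := idQ.
(* The set [B] below is the ideal Q + Ax. It is strictly larger than [M], so by maximality it must
   contain a power of [f]. *)
have maxQ x : ~ Q x -> exists n a q, Q q /\ f ^+ n = q + a * x.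
  move=> Qx; apply: contrapT => noQ.
  pose B := [set q + a * x | q in Q & a in [set: A]].
  have QB : Q `<=` B by move=> q Qq; exists q => //; exists 0; rewrite // mul0r addr0.
  apply: (maxM B).
    split; first by move=> y My; apply: QB; right.
    move=> BM; apply: Qx; right; apply: BM; exists 0 => //; exists 1 => //.
    by rewrite add0r mul1r.
  have IB : I `|` B = B by apply/setUidPr => y Iy; apply: QB; left.
  rewrite /P /mkset IB; split=> [|n [q Qq [a _ E]]]; last by apply: noQ; exists n, a, q.
  split=> [|_ _ [q Qq [a _ <-]] [q' Qq' [a' _ <-]]|b _ [q Qq [a _ <-]]].
  - exact: QB.
  - by exists (q + q'); [exact: QD | exists (a + a') => //; ring].
  - by exists (b * q); [exact: QM | exists (b * a) => //; ring].
have primeQ : prime_ideal Q.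
  split=> // [Q1|x y Qxy]; first by apply: (fQ 0%N).
  apply: contrapT => /not_orP[/maxQ[m [a [q [Qq mE]]]]].
  move=> /maxQ[n [b [q' [Qq' nE]]]]; apply: (fQ (m + n)%N).
  (* Each term of the expanded product has a factor [q], [q'] or [x * y], all of which lie in
     [Q]. *)
  rewrite exprD mE nE.
  have -> : (q + a * x) * (q' + b * y) =
    (q' + b * y) * q + (a * x * q' + a * b * (x * y)) by ring.
  by apply: (QD); [|apply: (QD)]; apply: (QM).
exists (Spec primeQ); split=> [y Iy|]; first by left.
exact: (fQ 1%N).
Qed.

(* Quasi-compactness of [D(f)] in ideal-theoretic form. *)
Lemma ideal_basic_open (A : comPzRingType) (I : set A) (f : A) : ideal I ->
    (forall p : spec A, ~ spec_set p f -> exists2 x, I x & ~ spec_set p x) ->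
  exists n, I (f ^+ n).
Proof.
move=> idI Ip; apply: contrapT => /forallNP/(prime_avoiding_powers idI).
by move=> [p [Ip' /Ip[x /Ip']]].
Qed.

(** The map [h] sends [r] to a / s whenever [g s * r = g a]. The kernel condition makes this
    independent of the choice, so each identity for [h] amounts to exhibiting one suitable
    fraction. *)
Lemma localization_iso (A R : comPzRingType) (S : mulset A)
    (g : {rmorphism A -> R}) :
    (forall s, mulset_set S s -> exists y, g s * y = 1) ->
    (forall a, g a = 0 -> exists2 s, mulset_set S s & s * a = 0) ->
    (forall r, exists s a, mulset_set S s /\ g s * r = g a) ->
  ring_iso R (localization S).
Proof.
move=> gU gker gsurj.
have reg s : mulset_set S s -> injective ( *%R (g s)).
  move=> /gU[y sy] x x' /(congr1 ( *%R y)).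
  by rewrite !mulrA ![y * _]mulrC sy !mul1r.
have /choice[h hP] : forall r, exists z : localization S,
    exists a s (Ss : mulset_set S s),
    g s * r = g a /\ z = \pi_(localization S) (Frac a Ss).
  move=> r; have [s [a [Ss E]]] := gsurj r.
  by exists (\pi_(localization S) (Frac a Ss)), a, s, Ss.
have hE r a s (Ss : mulset_set S s) : g s * r = g a -> h r = \pi_(localization S) (Frac a Ss).
  move=> E; have [b [t [St [E' ->]]]] := hP r; apply/frac_eqP.
  rewrite /num /den /=.
  have [|u Su uE] := gker (b * s - a * t).
    by rewrite rmorphB !rmorphM -E -E'; ring.
  by exists u => //; apply/eqP; rewrite -subr_eq0 -mulrBr uE.
have hB : zmod_morphism h.
  move=> x y; have [a [s [Ss [xE ->]]]] := hP x.
  have [b [t [St [yE ->]]]] := hP y.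
  rewrite -[X in _ = _ + X]pi_loc_opp -[RHS]pi_loc_add; apply: hE.
  by rewrite /num /den /= mulNr rmorphB !rmorphM -xE -yE; ring.
have hM : monoid_morphism h.
  split=> [|x y]; first by apply: hE; rewrite rmorph1 mulr1.
  have [a [s [Ss [xE ->]]]] := hP x.
  have [b [t [St [yE ->]]]] := hP y.
  by rewrite -[RHS]pi_loc_mul; apply: hE; rewrite /num /den /= !rmorphM -xE -yE; ring.
have h_inj : injective h.
  move=> x y; have [a [s [Ss [xE ->]]]] := hP x.
  have [b [t [St [yE ->]]]] := hP y => /frac_eqP[u Su].
  rewrite /num /den /= => /(congr1 g); rewrite !rmorphM -xE -yE => /(reg _ Su) E.
  by apply: (reg _ Ss); apply: (reg _ St); rewrite mulrC E; ring.
have h_surj z : exists x, h x = z.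
  elim/quotW: z => -[a [s Ss']]; have Ss := set_mem Ss'; have [y sy] := gU _ Ss.
  exists (g a * y); rewrite (hE _ a _ Ss); last by rewrite mulrCA sy mulr1.
  by rewrite /Frac (Prop_irrelevance (mem_set Ss) Ss').
have [k hk] := choice h_surj.
pose hz := GRing.isZmodMorphism.Build R (localization S) h hB.
pose hm := GRing.isMonoidMorphism.Build R (localization S) h hM.
pose H : {rmorphism R -> localization S} := HB.pack h hz hm.
by exists H, k => // x; apply: h_inj; exact: hk.
Qed.

(** * Local description of an arbitrary associated sheaf *)

Section AssociatedSheaf.
Variables (X : topologicalType) (F FF : presheaf X) (theta : presheaf_hom F FF).
Hypothesis FF_associated : is_associated_sheaf theta.

Definition id_hom (G : presheaf X) : presheaf_hom G G :=
  @PresheafHom X G G (fun U => idfun) (fun U V VU s => erefl).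

Lemma comp_hom_res (G H K : presheaf X) (g : presheaf_hom H K)
    (h : presheaf_hom G H) (U V : opens X) (VU : V `<=` U) s :
  (g V \o h V) (res G VU s) = res K VU ((g U \o h U) s).
Proof. by rewrite /= !hom_res. Qed.

Definition comp_hom (G H K : presheaf X) (g : presheaf_hom H K)
    (h : presheaf_hom G H) : presheaf_hom G K :=
  @PresheafHom X G K (fun U => g U \o h U) (comp_hom_res g h).

(** The explicit sheafification map factors through [theta], and there equal sections have equal
    germs in [F]. *)
Lemma associated_locally_inj (U : opens X) (s t : F U) (p : X) :
    opens_set U p -> theta U s = theta U t ->
  exists (V : opens X) (VU : V `<=` U),
    opens_set V p /\ res F VU s = res F VU t.
Proof.
move=> Up st; have [_ univ] := FF_associated.
have [psi [psiE _]] := univ _ (@sheafify_is_sheaf X F) (sheafify_hom F).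
have : sheafify_hom F U s = sheafify_hom F U t by rewrite !psiE st.
move=> /(congr1 (fun r : sheafify_sections F U => val r (opens_pt Up))) /=.
rewrite !(etale_unitE _ _ Up) => /germ_eqP[W [Ws [Wt [Wp /= E]]]].
by exists W, Ws; split=> //; rewrite E (Prop_irrelevance Wt Ws).
Qed.

(** Sections of the explicit sheafification locally come from [F]; the comparison map [chi] carries
    this over to [FF]. *)
Lemma associated_locally_surj (U : opens X) (r : FF U) (p : X) :
    opens_set U p ->
  exists (V : opens X) (VU : V `<=` U) (t : F V),
    opens_set V p /\ res FF VU r = theta V t.
Proof.
move=> Up; have [FF_sheaf univ] := FF_associated.
have [psi [psiE _]] := univ _ (@sheafify_is_sheaf X F) (sheafify_hom F).
have [_ univ'] := sheafify_associated F.
have [chi [chiE _]] := univ' _ FF_sheaf theta.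
have [id' [_ uniq_id]] := univ _ FF_sheaf theta.
(* The composite of [chi] and [psi] and the identity both factor [theta] through itself, so
   uniqueness identifies them. *)
have chi_psi V (x : FF V) : chi V (psi V x) = x.
  transitivity (id' V x).
    by apply: (uniq_id (comp_hom chi psi)) => W y; rewrite /= -psiE -chiE.
  by symmetry; apply: (uniq_id (id_hom FF)).
have [V [t [VU Vp st]]] := set_mem (valP (psi U r)) p Up.
exists V, VU, t; split=> //; rewrite -[r]chi_psi -hom_res chiE; congr (chi V _).
apply: sheafify_eq => q Vq.
by rewrite /= (etale_resE _ _ _ (VU _ Vq)) (st _ _ Vq) (etale_unitE _ _ Vq).
Qed.

End AssociatedSheaf.

(** * Germs as ring morphisms *)

Section Germs.
Variables (X : topologicalType) (F : presheaf X).

Lemma germ_is_zmod_morphism (x : X) (U : opens X) (Ux : opens_set U x) :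
  zmod_morphism (@germ X F x U Ux).
Proof. by move=> s t; rewrite -germDE -germNE. Qed.
Lemma germ_is_monoid_morphism (x : X) (U : opens X) (Ux : opens_set U x) :
  monoid_morphism (@germ X F x U Ux).
Proof. by split=> [|s t]; [rewrite -germ1E | rewrite -germME]. Qed.
HB.instance Definition _ x U Ux := GRing.isZmodMorphism.Build
  (F U) (stalk F x) (@germ X F x U Ux) (@germ_is_zmod_morphism x U Ux).
HB.instance Definition _ x U Ux := GRing.isMonoidMorphism.Build
  (F U) (stalk F x) (@germ X F x U Ux) (@germ_is_monoid_morphism x U Ux).

Lemma germ_inj (U : opens X) (s t : F U) : is_sheaf F ->
  (forall x (Ux : opens_set U x), germ Ux s = germ Ux t) -> s = t.
Proof.
move=> sheafF st; apply: (sheaf_eq sheafF) => x Ux.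
have /germ_eqP[W [Ws [Wt [Wx /= E]]]] := st x Ux.
by exists W, Ws; split=> //; rewrite E (Prop_irrelevance Wt Ws).
Qed.

End Germs.

(** * Units and fractions in the presheaf of rings *)

Section PresheafO.
Variable A : comPzRingType.
Implicit Types (U V : opens (spec A)) (p : spec A) (a f s : A).

Lemma basic_openP f p : opens_set (basic_open f) p <-> ~ spec_set p f.
Proof. by []. Qed.

Lemma spec_mulP p a s : spec_set p (a * s) <-> spec_set p a \/ spec_set p s.
Proof.
have [[_ _ pM] _ pP] := spec_prime p; split=> [/pP//|[pa|/pM //]].
by rewrite mulrC; exact: pM.
Qed.

Lemma basic_openM a s :
  basic_open (a * s) = basic_open a `&` basic_open s :> set (spec A).
Proof.
by apply/seteqP; split=> p; rewrite /= /basic_open_set /= spec_mulP not_orP.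
Qed.

Lemma basic_open_exp f n : basic_open f `<=` basic_open (f ^+ n).
Proof.
move=> p /basic_openP pf; apply/basic_openP.
elim: n => [|n IHn]; first by rewrite expr0; have [] := spec_prime p.
by rewrite exprS spec_mulP => -[].
Qed.

Lemma basic_open_base U p : opens_set U p ->
  exists f, ~ spec_set p f /\ basic_open f `<=` U.
Proof.
move=> Up; have [I idI UI] := opens_open U.
have /existsNP[f /not_implyP[If pf]] : ~ zeros I p by rewrite -UI; apply.
exists f; split=> // q qf; apply: contrapT => Uq.
have : zeros I q by rewrite -UI.
by move=> /(_ f If).
Qed.

Lemma rho_at_eq0 p a : rho_at p a = 0 -> exists2 u, ~ spec_set p u & u * a = 0.
Proof.
move=> /frac_eqP[u pu]; rewrite /num /den /= mulr1 mul0r mulr0 => ua.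
by exists u.
Qed.

(** Read at every point of an open set, this turns invertibility of [rho U s] into the inclusion of
    [U] in D(s). *)
Lemma rho_at_unit p s : (exists y, rho_at p s * y = 1) <-> ~ spec_set p s.
Proof.
split=> [[]|ps].
  elim/quotW=> -[b [t pt]]; rewrite -[X in X = _]pi_loc_mul => /frac_eqP[u pu].
  rewrite /num /den /= mulr1 !mul1r => uE ps.
  have : spec_set p (u * t) by rewrite -uE !spec_mulP; auto.
  by rewrite spec_mulP => -[/pu|/(set_mem pt)].
exists (\pi_(loc_at p) (@Frac A (compl_prime p) 1 s ps)).
rewrite -[LHS]pi_loc_mul; apply/frac_eqP; exists 1; first exact: mulset1.
by rewrite /num /den /= /den /=; ring.
Qed.

Lemma tildeO_eq U (x y : tildeO U) : (forall q, x q = y q) -> x = y.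
Proof. exact: functional_extensionality_dep. Qed.

Lemma tildeO_mulE U (x y : tildeO U) q : (x * y) q = x q * y q.
Proof. by []. Qed.

Lemma tildeO_subE U (x y : tildeO U) q : (x - y) q = x q - y q.
Proof. by []. Qed.

Lemma rho_generated U a : rho U a \in generated_subring (O_generators U).
Proof. by apply/mem_set => B [_]; apply; left; exists a. Qed.

Definition rhoO U a : O_presheaf A U :=
  exist (fun t : tildeO U => t \in generated_subring (O_generators U))
    (rho U a) (rho_generated U a).

Lemma rhoO_is_zmod_morphism U : zmod_morphism (rhoO U).
Proof.
move=> a b; apply: val_inj; apply: functional_extensionality_dep => p.
exact: (rmorphB (rho_at (val p))).
Qed.
Lemma rhoO_is_monoid_morphism U : monoid_morphism (rhoO U).
Proof.
split=> [|a b]; apply: val_inj; apply: functional_extensionality_dep => p.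
  exact: (rmorph1 (rho_at (val p))).
exact: (rmorphM (rho_at (val p))).
Qed.
HB.instance Definition _ U := GRing.isZmodMorphism.Build
  A (O_presheaf A U) (rhoO U) (rhoO_is_zmod_morphism U).
HB.instance Definition _ U := GRing.isMonoidMorphism.Build
  A (O_presheaf A U) (rhoO U) (rhoO_is_monoid_morphism U).

Lemma rhoO_res U V (VU : V `<=` U) a : res (O_presheaf A) VU (rhoO U a) = rhoO V a.
Proof. exact: val_inj. Qed.

Lemma rhoO_eq0 U a p : opens_set U p -> rhoO U a = 0 ->
  exists2 u, ~ spec_set p u & u * a = 0.
Proof.
move=> Up /(congr1 (fun t : O_sections U => val t (opens_pt Up))).
exact: rho_at_eq0.
Qed.

(** The inverses in the local rings form a family in [tildeO U] that is itself one of the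
    generators. *)
Lemma rhoO_unit U s : U `<=` basic_open s -> exists y, rhoO U s * y = 1.
Proof.
move=> Us.
have yP : forall p : (U : set (spec A)), exists y : loc_at (val p),
    rho_at (val p) s * y = 1.
  by move=> p; apply/rho_at_unit; exact: Us (set_mem (valP p)).
have [t tE] : exists t : tildeO U, forall q, rho_at (val q) s * t q = 1.
  by exists (fun q => projT1 (cid (yP q))) => q; exact: projT2 (cid (yP q)).
have {}tE : rho U s * t = 1.
  by apply: tildeO_eq => q; rewrite tildeO_mulE [LHS]tE.
have tO : t \in generated_subring (O_generators U).
  by apply/mem_set => B [_]; apply; right; exists s.
exists (exist (fun t : tildeO U => t \in generated_subring (O_generators U)) t tO).
exact: val_inj.
Qed.

(** Fractions with a single denominator over all of [U] form a subring, by taking common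
    denominators, and it contains the generators. *)
Lemma O_frac U (t : O_presheaf A U) :
  exists s a, U `<=` basic_open s /\ rhoO U s * t = rhoO U a.
Proof.
pose B := [set t : tildeO U | exists s a, U `<=` basic_open s /\
  forall q, rho_at (val q) s * t q = rho_at (val q) a].
have [s [a [Us E]]] : B (val t); last first.
  exists s, a; split=> //; apply: val_inj.
  by apply: tildeO_eq => q; rewrite [LHS]tildeO_mulE [LHS]E.
apply: (set_mem (valP t)); split; last first.
  move=> x [[a _ <-]|[s sx]].
    exists 1, a; split=> [p _|p]; first by rewrite /=; have [] := spec_prime p.
    by rewrite rmorph1 mul1r.
  have sxE q : rho_at (val q) s * x q = 1.
    by have := congr1 (fun f : tildeO U => f q) sx.
  (* The generator [x] is 1 / s, and its existence forces [s] to vanish nowhere on [U]. *)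
  exists s, 1; split=> [p Up|p]; last by rewrite sxE rmorph1.
  by apply/rho_at_unit; exists (x (opens_pt Up)); exact: sxE (opens_pt Up).
split=> [|x y /set_mem[s [a [Us xE]]] /set_mem[r [b [Ur yE]]]
         |x y /set_mem[s [a [Us xE]]] /set_mem[r [b [Ur yE]]]]; apply/mem_set.
- exists 1, 1; split=> [p _|p]; first by rewrite /=; have [] := spec_prime p.
  by rewrite mulr1.
- exists (s * r), (a * r - b * s); split=> [|p].
    by rewrite basic_openM subsetI.
  by rewrite tildeO_subE rmorphB !rmorphM -xE -yE; ring.
- exists (s * r), (a * b); split=> [|p].
    by rewrite basic_openM subsetI.
  by rewrite tildeO_mulE !rmorphM -xE -yE; ring.
Qed.

End PresheafO.

(** * Sections and stalks of the structure sheaf *)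

Section StructureSheaf.
Variables (A : comPzRingType) (OX : presheaf (spec A)).
Variable theta : presheaf_hom (O_presheaf A) OX.
Hypothesis OX_associated : is_associated_sheaf theta.
Implicit Types (U V : opens (spec A)) (p q : spec A) (a f s : A).

Let OX_sheaf : is_sheaf OX. Proof. by have [] := OX_associated. Qed.

Definition section_of U : {rmorphism A -> OX U} := theta U \o rhoO U.

Lemma section_of_res U V (VU : V `<=` U) a :
  res OX VU (section_of U a) = section_of V a.
Proof. by rewrite /= -hom_res rhoO_res. Qed.

Lemma section_of_unit U s :
  U `<=` basic_open s -> exists y, section_of U s * y = 1.
Proof.
by move=> /rhoO_unit[y sy]; exists (theta U y); rewrite /= -rmorphM sy rmorph1.
Qed.

Lemma section_of_reg U s (x y : OX U) : U `<=` basic_open s ->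
  section_of U s * x = section_of U s * y -> x = y.
Proof.
move=> /section_of_unit[z sz] /(congr1 ( *%R z)).
by rewrite !mulrA ![z * _]mulrC sz !mul1r.
Qed.

(** Vanishing in [OX] gives vanishing in the presheaf near [p], where the component at [p] can be
    read off in the local ring. *)
Lemma section_of_eq0 U a p : opens_set U p -> section_of U a = 0 ->
  exists2 u, ~ spec_set p u & u * a = 0.
Proof.
move=> Up a0; have : theta U (rhoO U a) = theta U 0 by rewrite rmorph0.
move=> /(associated_locally_inj OX_associated Up)[V [VU [Vp]]].
by rewrite rhoO_res rmorph0; exact: rhoO_eq0.
Qed.

Lemma section_locally_frac U (r : OX U) p : opens_set U p ->
  exists s a (sU : basic_open s `<=` U), ~ spec_set p s /\
    res OX sU (section_of U s * r) = section_of (basic_open s) a.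
Proof.
move=> Up.
have [V [VU [t [Vp rt]]]] := associated_locally_surj OX_associated r Up.
have [s [a [Vs E]]] := O_frac t.
have [h [ph hV]] := basic_open_base Vp.
have hsV : basic_open (h * s) `<=` V.
  by rewrite basic_openM; exact: subset_trans (@subIsetl _ _ _) hV.
(* Scaling the fraction a / s by [h] makes its denominator cut out the neighbourhood itself. *)
exists (h * s), (h * a), (subset_trans hsV VU); split.
  by rewrite spec_mulP => -[/ph|/(Vs p Vp)].
rewrite -(res_comp VU hsV) (rmorphM (res OX VU)) section_of_res rt.
rewrite (rmorphM (section_of V)) -mulrA -(rmorphM (theta V) (rhoO V s)) E.
by rewrite (rmorphM (res OX hsV)) !section_of_res -rmorphM.
Qed.

Lemma section_of_basic_eq0 f a : section_of (basic_open f) a = 0 ->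
  exists n, f ^+ n * a = 0.
Proof.
move=> a0; apply: (@ideal_basic_open A [set x | x * a = 0]) => [|p pf].
  split=> [|x y xa ya|b x xa] /=; first by rewrite mul0r.
    by rewrite mulrDl xa ya addr0.
  by rewrite -mulrA xa mulr0.
by have [u pu ua] := section_of_eq0 (U := basic_open f) pf a0; exists u.
Qed.

(** Near a point, [u] is a fraction b / t. Vanishing on D(s) makes [b] zero on D(st), so some power
    of [s * t] kills [b]; as [t] is a unit on D(t), a power of [s] kills [u] there. *)
Lemma section_supported_torsion f s (sf : basic_open s `<=` basic_open f)
    (u : OX (basic_open f)) : res OX sf u = 0 ->
  exists n, section_of (basic_open f) (s ^+ n) * u = 0.
Proof.
move: sf u; set U := basic_open f => sU u u0.
(* The exponent that works locally depends on the point; recording the bound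
   over [D(x)] makes [K] an ideal, since [D(x + y)] is covered by [D(x)] and
   [D(y)], so that no explicit finite subcover is needed. *)
pose K := [set x | exists n, forall q (Uq : opens_set U q), ~ spec_set q x ->
  germ Uq (section_of U (s ^+ n) * u) = 0].
have killS m n q (Uq : opens_set U q) : germ Uq (section_of U (s ^+ n) * u) = 0 ->
    germ Uq (section_of U (s ^+ (m + n)) * u) = 0.
  by move=> E; rewrite exprD (rmorphM (section_of U)) -mulrA rmorphM [X in _ * X]E mulr0.
have [|p pf|n [m fm]] := @ideal_basic_open A K f.
- split=> [|x y [m xm] [n yn]|a x [n xn]].
  + by exists 0%N => q Uq []; have [[]] := spec_prime q.
  + exists (m + n)%N => q Uq qxy.
    have [qx|/xm qx] := EM (spec_set q x); last by rewrite addnC; exact: killS.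
    have [qy|/yn qy] := EM (spec_set q y); last exact: killS.
    by case: qxy; have [[_ qD _] _ _] := spec_prime q; exact: qD.
  + by exists n => q Uq; rewrite spec_mulP => /not_orP[_]; exact: xn.
- have [t [b [tU [pt E]]]] := @section_locally_frac U u p pf.
  exists t => //.
  have stU : basic_open (s * t) `<=` U.
    by rewrite basic_openM; exact: subset_trans (@subIsetl _ _ _) sU.
  have stt : basic_open (s * t) `<=` basic_open t by rewrite basic_openM.
  have sts : basic_open (s * t) `<=` basic_open s by rewrite basic_openM.
  have [n nE] : exists n, (s * t) ^+ n * b = 0.
    apply: section_of_basic_eq0; rewrite -(section_of_res stt) -E.
    by rewrite (res_comp _ _ stU) (rmorphM (res OX stU)) -(res_comp sU sts stU u) u0
      rmorph0 mulr0.
  exists n => q Uq qt.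
  rewrite -(germ_res Uq (qt : opens_set (basic_open t) q) tU) (_ : res OX tU _ = 0) ?rmorph0 //.
  (* Of these factors [t], one turns [u] into [b] and the other [n] complete [(s * t) ^+ n], which
     kills [b]. *)
  apply: (@section_of_reg _ (t ^+ n.+1)).
    exact: basic_open_exp.
  rewrite mulr0 rmorphM section_of_res.
  transitivity (section_of (basic_open t) ((s * t) ^+ n) *
    res OX tU (section_of U t * u)).
    rewrite rmorphM section_of_res exprMn exprS !(rmorphM (section_of _)).
    by ring.
  by rewrite E -(rmorphM (section_of _)) nE rmorph0.
(* Since D(f) lies in D(f^n), the bound [m] attached to [f ^+ n] holds at every point of [U]. *)
exists m; apply: germ_inj => // q Uq; rewrite rmorph0; apply: fm.
exact: basic_open_exp Uq.
Qed.

(** An element [s] outside [p] becomes a unit on its own neighbourhood D(s); kernel and denominators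
    are already controlled near [p]. *)
Lemma stalk_iso p : ring_iso (stalk OX p) (loc_at p).
Proof.
pose T : opens (spec A) := Opens openT; have Tp : opens_set T p by [].
pose g : {rmorphism A -> stalk OX p} := germ Tp \o section_of T.
have gE U (Up : opens_set U p) a : g a = germ Up (section_of U a).
  by rewrite -(@section_of_res T U (@subsetT _ U)) germ_res.
apply: (@localization_iso _ _ _ g) => [s ps|a|r].
- have [y sy] := @section_of_unit (basic_open s) s (fun _ => id).
  exists (@germ _ _ p (basic_open s) ps y).
  by rewrite (gE (basic_open s) ps) -rmorphM sy rmorph1.
- rewrite -(rmorph0 (@germ _ _ p T Tp)) => /germ_eqP[W [WT [WT' [Wp /=]]]].
  by rewrite rmorph0 section_of_res; exact: section_of_eq0.
- have [U [Up [t ->]]] := germP r.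
  have [s [a [sU [ps E]]]] := section_locally_frac t Up.
  exists s, a; split=> //.
  rewrite (gE _ Up); transitivity (germ Up (section_of U s * t)).
    by rewrite rmorphM.
  rewrite -(germ_res Up (ps : opens_set (basic_open s) p) sU) E.
  exact/esym/gE.
Qed.

Lemma sections_basic_open_iso f : ring_iso (OX (basic_open f)) (loc_elt f).
Proof.
pose U := basic_open f.
apply: (@localization_iso _ _ _ (section_of U)) => [_ [n _ <-]|a a0|r].
- exact/section_of_unit/basic_open_exp.
- have [n nE] := section_of_basic_eq0 a0.
  by exists (f ^+ n) => //; exists n.
(* The conductor of [r]: local denominators of [r] have a power in it. *)
pose J := [set x | exists a, section_of U x * r = section_of U a].
have [|p pf|n [a nE]] := @ideal_basic_open A J f; last first.
- by exists (f ^+ n), a; split=> //; exists n.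
- have [s [a [sU [ps E]]]] := @section_locally_frac U r p pf.
  (* The relation s r = a holds only over D(s). Multiplying by [s ^+ n] makes it hold over [U],
     which puts [s ^+ n.+1] in [J] with numerator [s ^+ n * a]. *)
  have [|n nE] := @section_supported_torsion f s sU
    (section_of U s * r - section_of U a).
    by rewrite rmorphB E section_of_res subrr.
  exists (s ^+ n.+1); last exact: basic_open_exp ps.
  exists (s ^+ n * a); apply/eqP; rewrite -subr_eq0 exprSr !(rmorphM (section_of U)).
  by rewrite -mulrA -mulrBr nE.
split=> [|x y [a xa] [b yb]|b x [a xa]].
- by exists 0; rewrite !rmorph0 mul0r.
- by exists (a + b); rewrite !(rmorphD (section_of U)) mulrDl xa yb.
- by exists (b * a); rewrite !(rmorphM (section_of U)) -mulrA xa.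
Qed.

End StructureSheaf.

Theorem proposition1 (A : comPzRingType) (OX : presheaf (spec A))
    (theta : presheaf_hom (O_presheaf A) OX)
    (OX_associated : is_associated_sheaf theta) :
  (forall p : spec A, ring_iso (stalk OX p) (loc_at p)) /\
  (forall f : A, ring_iso (OX (basic_open f)) (loc_elt f)).
Proof.
split=> [p|f]; first exact: stalk_iso OX_associated p.
exact: sections_basic_open_iso OX_associated f.
Qed.
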